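(* Let $k$ be a commutative ring with unity, $A$ an associative $k$-algebra, $M,N$ left $A$-modules, $\phi:M\to N$ an $A$-module homomorphism, and $(\xi_t,\eta_t,\phi_t)$ a deformation of $\phi$ of order $n$. Then $(\xi_t,\eta_t,\phi_t)$ extends to a deformation of $\phi$ of order $n+1$ if and only if the cohomology class in $H^2(\phi)$ of the $(n+1)$th obstruction $Ob_{n+1}(\phi_t)$ vanishes.
   Context: Write $\otimes=\otimes_k$. For an $A$-bimodule $F$, put $C^n(A;F)=\mathrm{Hom}_k(A^{\otimes n},F)$ for $n\ge 0$ (so $C^0(A;F)=F$), with the Hochschild coboundary $\delta^n:C^n(A;F)\to C^{n+1}(A;F)$ given for $n\ge1$ by $$\delta^n f(x_1,\dots,x_{n+1})=x_1f(x_2,\dots,x_{n+1})+\sum_{i=1}^{n}(-1)^i f(x_1,\dots,x_ix_{i+1},\dots,x_{n+1})+(-1)^{n+1}f(x_1,\dots,x_n)x_{n+1},$$ and $\delta^0(m)(a)=am-ma$. For left $A$-modules $P,Q$, $\mathrm{Hom}_k(P,Q)$ is the $A$-bimodule with $(rf)(m)=r(f(m))$, $(fs)(m)=f(sm)$; $\mathrm{End}(P)=\mathrm{Hom}_k(P,P)$. For $n\ge 1$ let $C^n(\phi)=C^n(A;\mathrm{End}(M))\oplus C^n(A;\mathrm{End}(N))\oplus C^{n-1}(A;\mathrm{Hom}_k(M,N))$ and $d^n:C^n(\phi)\to C^{n+1}(\phi)$, $$d^n(u,v,w)=(\delta^n u,\ \delta^n v,\ \phi u-v\phi-\delta^{n-1}w),$$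 where $(\phi u)(x_1,\dots,x_n)(m)=\phi(u(x_1,\dots,x_n)(m))$ and $(v\phi)(x_1,\dots,x_n)(m)=v(x_1,\dots,x_n)(\phi(m))$. These satisfy $d^{n+1}d^n=0$, and $H^2(\phi)=\ker d^2/\operatorname{im} d^1$. Let $\xi:A\to\mathrm{End}(M)$, $\xi(r)m=rm$, be the action map of $M$. A deformation of order $n$ of $M$ is $\xi_t=\sum_{i=0}^n\xi_it^i$ with $\xi_i\in\mathrm{Hom}_k(A,\mathrm{End}(M))$, $\xi_0=\xi$, and $\xi_t(rs)=\xi_t(r)\xi_t(s)$ modulo $t^{n+1}$, i.e. $\xi_l(rs)=\sum_{i+j=l}\xi_i(r)\xi_j(s)$ for all $r,s\in A$, $0\le l\le n$; similarly for $N$. A deformation of order $n$ of $\phi$ is a triple $(\xi_t,\eta_t,\phi_t)$ where $\xi_t=\sum_{i=0}^n\xi_it^i$, $\eta_t=\sum_{i=0}^n\eta_it^i$ are deformations of order $n$ of $M$ and $N$, and $\phi_t=\sum_{i=0}^n\phi_it^i$ with $\phi_i\in\mathrm{Hom}_k(M,N)$, $\phi_0=\phi$, and $\phi_t(\xi_t(r)m)=\eta_t(r)\phi_t(m)$ modulo $t^{n+1}$, i.e. $\sum_{i+j=l}\phi_i(\xi_j(r)m)=\sum_{i+j=l}\eta_i(r)(\phi_j(m))$ for all $r\in A$, $m\in M$, $0\le l\le n$. It extends to a deformation of order $n+1$ if there is $(\xi_{n+1},\eta_{n+1},\phi_{n+1})\in C^1(\phi)$ such that $(\xi_t+\xi_{n+1}t^{n+1},\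 \eta_t+\eta_{n+1}t^{n+1},\ \phi_t+\phi_{n+1}t^{n+1})$ is a deformation of $\phi$ of order $n+1$. The $(n+1)$th obstruction cochain of $(\xi_t,\eta_t,\phi_t)$ is $Ob_{n+1}(\phi_t)=(O_1,O_2,O_3)\in C^2(\phi)$ with, for $a,b\in A$ (all sums over $i+j=n+1$, $i,j>0$), $$O_1(a,b)=-\sum\xi_i(a)\xi_j(b),\qquad O_2(a,b)=-\sum\eta_i(a)\eta_j(b),\qquad O_3(a)=\sum\eta_i(a)\circ\phi_j-\sum\phi_i\circ\xi_j(a).$$ It is a 2-cocycle, so it has a class in $H^2(\phi)$; this class vanishes iff $Ob_{n+1}(\phi_t)\in\operatorname{im} d^1$. *)

(* Defs.v *)
From HB Require Import structures.
From mathcomp Require Import all_boot all_algebra.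
From mathcomp Require Import boolp functions zify.

Set Implicit Arguments.
Unset Strict Implicit.
Unset Printing Implicit Defensive.

Import GRing.Theory.
Local Open Scope ring_scope.

Section LinearMaps.
Variables (k : comPzRingType) (P Q : lmodType k).
Implicit Types f g h : {linear P -> Q}.

Lemma linear_ext f g : f =1 g -> f = g.
Proof.
move=> /funext; case: f g => [f cf] [g cg] /= fg; subst g.
congr GRing.Linear.Pack.
case: cf cg => [[a] [b]] [[c] [d]].
by congr GRing.Linear.Class; congr (_ _); exact: Prop_irrelevance.
Qed.

Definition linear_pack (f : P -> Q) (lf : linear f) : {linear P -> Q} :=
  HB.pack_for {linear P -> Q} f (GRing.isLinear.Build k P Q *:%R f lf).

Definition hom_zero : {linear P -> Q} := \0.
Definition hom_add f g : {linear P -> Q} := f \+ g.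
Definition hom_opp f : {linear P -> Q} := \- f.
Definition hom_scale (c : k) f : {linear P -> Q} := c \*: f.

HB.instance Definition _ := gen_eqMixin {linear P -> Q}.
HB.instance Definition _ := gen_choiceMixin {linear P -> Q}.

Fact hom_addA : associative hom_add.
Proof. by move=> f g h; apply: linear_ext => x; rewrite /= addrA. Qed.
Fact hom_addC : commutative hom_add.
Proof. by move=> f g; apply: linear_ext => x; rewrite /= addrC. Qed.
Fact hom_add0 : left_id hom_zero hom_add.
Proof. by move=> f; apply: linear_ext => x; rewrite /= add0r. Qed.
Fact hom_addN : left_inverse hom_zero hom_opp hom_add.
Proof. by move=> f; apply: linear_ext => x; rewrite /= addNr. Qed.

HB.instance Definition _ := GRing.isZmodule.Build {linear P -> Q}
  hom_addA hom_addC hom_add0 hom_addN.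

Fact hom_scaleA a b f : hom_scale a (hom_scale b f) = hom_scale (a * b) f.
Proof. by apply: linear_ext => x; rewrite /= scalerA. Qed.
Fact hom_scale1 : left_id 1 hom_scale.
Proof. by move=> f; apply: linear_ext => x; rewrite /= scale1r. Qed.
Fact hom_scaleDr : right_distributive hom_scale +%R.
Proof. by move=> a f g; apply: linear_ext => x; rewrite /= scalerDr. Qed.
Fact hom_scaleDl f : {morph hom_scale^~ f : a b / a + b}.
Proof. by move=> a b; apply: linear_ext => x; rewrite /= scalerDl. Qed.

HB.instance Definition _ := GRing.Zmodule_isLmodule.Build k {linear P -> Q}
  hom_scaleA hom_scale1 hom_scaleDr hom_scaleDl.

Lemma hom0E x : (0 : {linear P -> Q}) x = 0. Proof. by []. Qed.
Lemma homDE f g x : (f + g) x = f x + g x. Proof. by []. Qed.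
Lemma homNE f x : (- f) x = - f x. Proof. by []. Qed.
Lemma homZE c f x : (c *: f) x = c *: f x. Proof. by []. Qed.
Lemma hom_sumE (I : Type) (r : seq I) (p : pred I) (F : I -> {linear P -> Q}) x :
  (\sum_(i <- r | p i) F i) x = \sum_(i <- r | p i) F i x.
Proof. by elim/big_rec2: _ => // i y z _ <-. Qed.

End LinearMaps.

Definition homE := (hom0E, homDE, homNE, homZE, hom_sumE).

Section Composition.
Variables (k : comPzRingType) (P Q S : lmodType k).

Definition hom_comp (g : {linear Q -> S}) (f : {linear P -> Q}) :
  {linear P -> S} := g \o f.

Fact hom_comp_linear_r g : linear (hom_comp g).
Proof. by move=> c f f'; apply: linear_ext => x; rewrite /= linearP. Qed.
Fact hom_comp_linear_l f : linear (hom_comp^~ f).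
Proof. by move=> c g g'; apply: linear_ext. Qed.

Definition postcomp g : {linear {linear P -> Q} -> {linear P -> S}} :=
  linear_pack (hom_comp_linear_r g).
Definition precomp f : {linear {linear Q -> S} -> {linear P -> S}} :=
  linear_pack (hom_comp_linear_l f).

Fact postcomp_linear : linear postcomp.
Proof. by move=> c g g'; apply: linear_ext => f; apply: linear_ext. Qed.
Fact precomp_linear : linear precomp.
Proof.
by move=> c f f'; apply: linear_ext => g; apply: linear_ext => x /=;
  rewrite linearP.
Qed.

End Composition.

(* Neither an associative algebra nor its modules are required to be unital;
   a k-bilinear map U x V -> W is an element of
   {linear U -> {linear V -> W}}. *)
Record assocAlgebra (k : comPzRingType) := AssocAlgebra {
  alg_sort :> lmodType k;
  amul : {linear alg_sort -> {linear alg_sort -> alg_sort}};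
  amulA : forall a b c, amul a (amul b c) = amul (amul a b) c
}.
Arguments amul {k A} : rename.

Record leftModule (k : comPzRingType) (A : assocAlgebra k) := LeftModule {
  mod_sort :> lmodType k;
  act : {linear A -> {linear mod_sort -> mod_sort}};
  actM : forall a b m, act (amul a b) m = act a (act b m)
}.
Arguments act {k A} M : rename.

Record bimodule (k : comPzRingType) (A : assocAlgebra k) := Bimodule {
  bimod_sort :> lmodType k;
  lact : {linear A -> {linear bimod_sort -> bimod_sort}};
  ract : {linear A -> {linear bimod_sort -> bimod_sort}};
  lactM : forall a b x, lact (amul a b) x = lact a (lact b x);
  ractM : forall a b x, ract (amul a b) x = ract b (ract a x);
  lractC : forall a b x, lact a (ract b x) = ract b (lact a x)
}.
Arguments lact {k A F} : rename.
Arguments ract {k A F} : rename.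

(* The module homomorphisms over A; k-linearity is stated separately since A
   need not have a unit. *)
Record moduleHom (k : comPzRingType) (A : assocAlgebra k)
    (M N : leftModule A) := ModuleHom {
  mhom :> {linear M -> N};
  mhomA : forall a m, mhom (act M a m) = act N a (mhom m)
}.

Section HomBimodule.
Variables (k : comPzRingType) (A : assocAlgebra k) (P Q : leftModule A).

Fact hom_lact_linear : linear (fun r : A => postcomp P (act Q r)).
Proof. by move=> c r s; rewrite linearP postcomp_linear. Qed.
Fact hom_ract_linear : linear (fun s : A => precomp Q (act P s)).
Proof. by move=> c r s; rewrite linearP precomp_linear. Qed.

Definition hom_lact := linear_pack hom_lact_linear.
Definition hom_ract := linear_pack hom_ract_linear.

Fact hom_lactM a b f :
  hom_lact (amul a b) f = hom_lact a (hom_lact b f).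
Proof. by apply: linear_ext => x /=; rewrite actM. Qed.
Fact hom_ractM a b f :
  hom_ract (amul a b) f = hom_ract b (hom_ract a f).
Proof. by apply: linear_ext => x /=; rewrite actM. Qed.
Fact hom_lractC a b f :
  hom_lact a (hom_ract b f) = hom_ract b (hom_lact a f).
Proof. exact: linear_ext. Qed.

Definition homBimodule : bimodule A :=
  Bimodule hom_lactM hom_ractM hom_lractC.

End HomBimodule.

Definition endBimodule (k : comPzRingType) (A : assocAlgebra k)
  (P : leftModule A) : bimodule A := homBimodule P P.

Section Multilinear.
Variables (k : comPzRingType) (n : nat) (U F : lmodType k).

Definition multilinear (f : ('I_n -> U) -> F) : Prop :=
  forall (i : 'I_n) (x : 'I_n -> U), linear (fun a => f [eta x with i |-> a]).

Definition multilinear_pred : {pred ('I_n -> U) -> F} :=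
  fun f => `[< multilinear f >].

Fact multilinearP f : reflect (multilinear f) (f \in multilinear_pred).
Proof. exact: asboolP. Qed.

Fact multilinear_submod : submod_closed multilinear_pred.
Proof.
split=> [|c f g lf lg]; apply/multilinearP => i x a u v.
  by rewrite /= scaler0 addr0.
move/multilinearP: lf => lf; move/multilinearP: lg => lg.
rewrite !fctE lf lg !scalerDr !scalerA [c * a]mulrC.
by rewrite addrACA.
Qed.

HB.instance Definition _ :=
  GRing.isSubmodClosed.Build k (('I_n -> U) -> F) multilinear_pred
    multilinear_submod.

(* Hom_k (U^{\otimes n}, F), as k-multilinear maps in n arguments; for n = 0
   the argument type has a single element and this is a copy of F. *)
Record cochain := Cochain {
  cochain_fun :> ('I_n -> U) -> F;
  cochainP : cochain_fun \in multilinear_pred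
}.

HB.instance Definition _ := [isSub for cochain_fun].
HB.instance Definition _ := [Choice of cochain by <:].
HB.instance Definition _ := [SubChoice_isSubLmodule of cochain by <:].

Lemma cochain_multilinear (f : cochain) : multilinear f.
Proof. exact/multilinearP/cochainP. Qed.

Definition mk_cochain (f : ('I_n -> U) -> F) (mf : multilinear f) : cochain :=
  Cochain (introT (multilinearP f) mf).

Lemma cochain_ext (f g : cochain) : (forall x, f x = g x) -> f = g.
Proof. by move=> fg; apply: val_inj; apply: funext. Qed.

Lemma cochain0E x : (0 : cochain) x = 0. Proof. by []. Qed.
Lemma cochainDE (f g : cochain) x : (f + g) x = f x + g x. Proof. by []. Qed.
Lemma cochainNE (f : cochain) x : (- f) x = - f x. Proof. by []. Qed.
Lemma cochainZE c (f : cochain) x : (c *: f) x = c *: f x. Proof. by []. Qed.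

End Multilinear.
Arguments cochain {k} n U F.

Definition cochainE := (cochain0E, cochainDE, cochainNE, cochainZE).

Section Hochschild.
Variables (k : comPzRingType) (A : assocAlgebra k).

(* For x = (x_1, ..., x_{n+1}): tail_arg x = (x_2, ..., x_{n+1}),
   init_arg x = (x_1, ..., x_n), and merge_arg i x is x with the entries of
   (0-based) positions i and i + 1 replaced with their product. *)
Definition tail_arg n (x : 'I_n.+1 -> A) : 'I_n -> A :=
  fun j => x (lift ord0 j).

Definition init_arg n (x : 'I_n.+1 -> A) : 'I_n -> A :=
  fun j => x (widen_ord (leqnSn n) j).

Definition merge_arg n (i : 'I_n) (x : 'I_n.+1 -> A) : 'I_n -> A := fun j =>
  if (j < i)%N then x (widen_ord (leqnSn n) j)
  else if j == i then amul (x (widen_ord (leqnSn n) j)) (x (lift ord0 j))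
  else x (lift ord0 j).

Lemma multilinear_slot n (F : lmodType k) (f : cochain n A F) (g : A -> A)
    (G : A -> 'I_n -> A) i y :
    linear g -> (forall a, G a =1 [eta y with i |-> g a]) ->
  linear (fun a => f (G a)).
Proof.
move=> lg GE c u v; have {}GE a : G a = [eta y with i |-> g a].
  exact/funext/GE.
by rewrite !GE lg cochain_multilinear.
Qed.

Lemma linear_amulr b : linear (amul^~ b : A -> A).
Proof. by move=> c u v; rewrite linearP. Qed.

Lemma ord_cases (n : nat) (i j : 'I_n) : (i == j) = (i == j :> nat).
Proof. by []. Qed.

Lemma lift0E n (i : 'I_n) : lift ord0 i = i.+1 :> nat. Proof. by []. Qed.

Lemma merge_arg_linear n (F : lmodType k) (f : cochain n A F) j i x :
  linear (fun a => f (merge_arg j [eta x with i |-> a])).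
Proof.
have lid : linear (id : A -> A) by [].
have ln := ltn_ord i.
case: (ltngtP i j) => [ij|ji|ij].
- have lin : (i < n)%N by exact: ltn_trans ij _.
  apply: (@multilinear_slot _ _ _ id _ (Ordinal lin) (merge_arg j x)) => // a p.
  rewrite /merge_arg /= !ord_cases lift0E /=.
  by repeat case: ifP => //; lia.
- have [ji1|ji1] := eqVneq (i : nat) j.+1.
    apply: (@multilinear_slot _ _ _ (amul (x (widen_ord (leqnSn n) j))) _ j
      (merge_arg j x)) => [|a p]; first exact: linearP.
    rewrite /merge_arg /= !ord_cases lift0E /=.
    repeat case: ifP => //; try lia.
    by move=> _ _ /eqP/val_inj ->.
  have lin : (i.-1 < n)%N by lia.
  apply: (@multilinear_slot _ _ _ id _ (Ordinal lin) (merge_arg j x)) => // a p.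
  rewrite /merge_arg /= !ord_cases lift0E /=.
  by repeat case: ifP => //; lia.
- apply: (@multilinear_slot _ _ _ (amul^~ (x (lift ord0 j))) _ j
    (merge_arg j x)) => [|a p]; first exact: linear_amulr.
  rewrite /merge_arg /= !ord_cases lift0E /=.
  repeat case: ifP => //; try lia.
  by move=> _ _ /eqP/val_inj ->.
Qed.

Lemma tail_arg_update n (i : 'I_n.+1) (x : 'I_n.+1 -> A) a :
  tail_arg [eta x with i |-> a] =
  if unlift ord0 i is Some j then [eta tail_arg x with j |-> a]
  else tail_arg x.
Proof.
case: unliftP => [j ->|->]; apply: funext => p; rewrite /tail_arg /=.
  by rewrite (inj_eq (@lift_inj _ _)).
by [].
Qed.

Lemma widen_ord_max n (i : 'I_n) : widen_ord (leqnSn n) i = lift ord_max i.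
Proof. by apply: val_inj; rewrite /= /bump leqNgt ltn_ord. Qed.

Lemma init_arg_update n (i : 'I_n.+1) (x : 'I_n.+1 -> A) a :
  init_arg [eta x with i |-> a] =
  if unlift ord_max i is Some j then [eta init_arg x with j |-> a]
  else init_arg x.
Proof.
case: unliftP => [j ->|->]; apply: funext => p; rewrite /init_arg /=.
  by rewrite !widen_ord_max (inj_eq (@lift_inj _ _)).
by rewrite widen_ord_max eq_sym (negPf (neq_lift _ _)).
Qed.

Section Coboundary.
Variable F : bimodule A.

Definition hochschild_fun n (f : cochain n A F) (x : 'I_n.+1 -> A) : F :=
  lact (x ord0) (f (tail_arg x))
  + \sum_(i < n) (-1) ^+ i.+1 *: f (merge_arg i x)
  + (-1) ^+ n.+1 *: ract (x ord_max) (f (init_arg x)).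

Lemma linear_add_comp (V W : lmodType k) (f g : V -> W) :
  linear f -> linear g -> linear (fun a => f a + g a).
Proof. by move=> lf lg c u v; rewrite lf lg scalerDr addrACA. Qed.

Lemma linear_scale_comp (V W : lmodType k) c (f : V -> W) :
  linear f -> linear (fun a => c *: f a).
Proof. by move=> lf d u v; rewrite lf scalerDr !scalerA mulrC. Qed.

Lemma linear_sum_comp (V W : lmodType k) (I : Type) (r : seq I) (p : pred I)
    (f : I -> V -> W) :
  (forall i, linear (f i)) -> linear (fun a => \sum_(i <- r | p i) f i a).
Proof.
move=> lf d u v; rewrite scaler_sumr -big_split.
by apply: eq_bigr => i _; rewrite lf.
Qed.

Lemma hochschild_multilinear n (f : cochain n A F) :
  multilinear (hochschild_fun f).
Proof.
move=> i x; apply: linear_add_comp; first apply: linear_add_comp.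
- case: (unliftP ord0 i) (tail_arg_update i x) => [j ->|->] tE c u v;
    rewrite !tE /=.
    by rewrite cochain_multilinear linearP.
  by rewrite linearP.
- apply: linear_sum_comp => j; apply: linear_scale_comp.
  exact: merge_arg_linear.
- apply: linear_scale_comp.
  case: (unliftP ord_max i) (init_arg_update i x) => [j ->|->] tE c u v;
    rewrite !tE /=.
    rewrite (negPf (neq_lift _ _)).
    by rewrite cochain_multilinear linearP.
  by rewrite eqxx linearP.
Qed.

(* The Hochschild coboundary; for n = 0 the formula reads
   (hochschild m)(a) = a m - m a. *)
Definition hochschild n (f : cochain n A F) : cochain n.+1 A F :=
  mk_cochain (hochschild_multilinear f).

Fact hochschild_linear n : linear (@hochschild n).
Proof.
move=> c f g; apply: cochain_ext => x.
rewrite cochainDE cochainZE /= /hochschild_fun !cochainDE !cochainZE.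
rewrite [lact _ _]linearP [ract _ _]linearP !scalerDr scaler_sumr.
rewrite (eq_bigr (fun i : 'I_n => c *: ((-1) ^+ i.+1 *: f (merge_arg i x)) +
  (-1) ^+ i.+1 *: g (merge_arg i x))); last first.
  by move=> i _; rewrite cochainDE cochainZE scalerDr !scalerA mulrC.
rewrite big_split /= !scalerA [_ * c]mulrC.
by rewrite [X in X + _ = _]addrACA [LHS]addrACA.
Qed.

HB.instance Definition _ n :=
  GRing.isLinear.Build k _ _ *:%R (@hochschild n) (@hochschild_linear n).

End Coboundary.
End Hochschild.

Section Cohomology.
Variables (k : comPzRingType) (X Y Z : lmodType k).
Variables (f : {linear X -> Y}) (g : {linear Y -> Z}).

Definition cocycle_pred : {pred Y} := fun y => g y == 0.

Fact cocycle_submod : submod_closed cocycle_pred.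
Proof.
split=> [|c u v /eqP gu /eqP gv]; first by apply/eqP; rewrite linear0.
by apply/eqP; rewrite linearP gu gv scaler0 addr0.
Qed.

HB.instance Definition _ :=
  GRing.isSubmodClosed.Build k Y cocycle_pred cocycle_submod.

Record cocycle := Cocycle {
  cocycle_val :> Y;
  cocycleP : cocycle_val \in cocycle_pred
}.

HB.instance Definition _ := [isSub for cocycle_val].
HB.instance Definition _ := [Choice of cocycle by <:].
HB.instance Definition _ := [SubChoice_isSubLmodule of cocycle by <:].

Definition coboundary_pred : {pred cocycle} :=
  fun z => `[< exists x, f x = val z >].

Fact coboundary_zmod : zmod_closed coboundary_pred.
Proof.
split=> [|u v /asboolP[x fx] /asboolP[y fy]]; apply/asboolP.
  by exists 0; rewrite linear0.
by exists (x - y); rewrite linearB fx fy.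
Qed.

HB.instance Definition _ :=
  GRing.isZmodClosed.Build cocycle coboundary_pred coboundary_zmod.

(* ker g / im f, meant for f and g with g \o f = 0 *)
Definition cohomology : zmodType := Quotient.quot coboundary_pred.

Definition cohomology_class (y : Y) (gy : g y = 0) : cohomology :=
  (\pi_(Quotient.quot coboundary_pred) (Cocycle (introT eqP gy)))%qT.

End Cohomology.

Section CochainMap.
Variables (k : comPzRingType) (n : nat) (U F G : lmodType k).

Fact cochain_map_multilinear (g : {linear F -> G}) (f : cochain n U F) :
  multilinear (fun x => g (f x)).
Proof. by move=> i x c u v; rewrite cochain_multilinear linearP. Qed.

Definition cochain_map g f : cochain n U G :=
  mk_cochain (cochain_map_multilinear g f).

Lemma cochain_map_linear g : linear (cochain_map g).
Proof.
move=> c f h; apply: cochain_ext => x.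
by rewrite cochainDE cochainZE; exact: (linearP g c (f x) (h x)).
Qed.

End CochainMap.

Section Complex.
Variables (k : comPzRingType) (A : assocAlgebra k) (M N : leftModule A).
Variable phi : moduleHom M N.

(* C^n(phi), only meaningful for n >= 1 *)
Definition Cphi (n : nat) : lmodType k :=
  (cochain n A {linear M -> M} * cochain n A {linear N -> N}
   * cochain n.-1 A {linear M -> N})%type.

(* dphi m is the differential d^{m+1} : C^{m+1}(phi) -> C^{m+2}(phi). *)
Definition dphi (m : nat) (c : Cphi m.+1) : Cphi m.+2 :=
  let: (u, v, w) := c in
  (hochschild (F := endBimodule M) u,
   hochschild (F := endBimodule N) v,
   cochain_map (postcomp M phi) u - cochain_map (precomp N phi) v
   - hochschild (F := homBimodule M N) w).

Fact dphi_linear m : linear (@dphi m).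
Proof.
move=> c [[u v] w] [[u' v'] w']; rewrite /dphi /=.
congr (_, _, _); rewrite ?linearP //=.
rewrite !cochain_map_linear !scalerDr !scalerN !opprD.
by rewrite [X in X + _ = _]addrACA [LHS]addrACA.
Qed.

HB.instance Definition _ m :=
  GRing.isLinear.Build k _ _ *:%R (@dphi m) (@dphi_linear m).

(* ker d^2 / im d^1; see dphi_dphi for im d^1 being contained in ker d^2. *)
Definition H2 : zmodType := cohomology (@dphi 0) (@dphi 1).

End Complex.

Section Deformations.
Variables (k : comPzRingType) (A : assocAlgebra k).

(* A polynomial f_0 + f_1 t + ... + f_n t^n is the family of its coefficients,
   indexed by 'I_n.+1; add_term f y is f_t + y t^{n+1}. *)
Definition add_term (T : Type) n (f : 'I_n.+1 -> T) (y : T) : 'I_n.+2 -> T :=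
  fun i => if unlift ord_max i is Some j then f j else y.

Definition module_deformation (M : leftModule A) n
    (xi : 'I_n.+1 -> {linear A -> {linear M -> M}}) : Prop :=
  xi ord0 = act M /\
  forall (l : 'I_n.+1) (r s : A), xi l (amul r s) =
    \sum_(p : 'I_n.+1 * 'I_n.+1 | (p.1 + p.2 == l)%N)
      hom_comp (xi p.1 r) (xi p.2 s).

Variables (M N : leftModule A) (phi : moduleHom M N).

Definition hom_deformation n
    (xi : 'I_n.+1 -> {linear A -> {linear M -> M}})
    (eta : 'I_n.+1 -> {linear A -> {linear N -> N}})
    (phi_ : 'I_n.+1 -> {linear M -> N}) : Prop :=
  [/\ module_deformation xi, module_deformation eta, phi_ ord0 = phi
    & forall (l : 'I_n.+1) (r : A) (m : M),
        \sum_(p : 'I_n.+1 * 'I_n.+1 | (p.1 + p.2 == l)%N)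
          phi_ p.1 (xi p.2 r m)
        = \sum_(p : 'I_n.+1 * 'I_n.+1 | (p.1 + p.2 == l)%N)
          eta p.1 r (phi_ p.2 m)].

Record deformation (n : nat) := Deformation {
  def_xi : 'I_n.+1 -> {linear A -> {linear M -> M}};
  def_eta : 'I_n.+1 -> {linear A -> {linear N -> N}};
  def_phi : 'I_n.+1 -> {linear M -> N};
  deformationP : hom_deformation def_xi def_eta def_phi
}.

Definition extends n (D : deformation n) : Prop :=
  exists (xi' : {linear A -> {linear M -> M}})
         (eta' : {linear A -> {linear N -> N}})
         (phi' : {linear M -> N}),
    hom_deformation (add_term (def_xi D) xi') (add_term (def_eta D) eta')
      (add_term (def_phi D) phi').

End Deformations.

Section Obstruction.
Variables (k : comPzRingType) (A : assocAlgebra k).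

Section ModuleObstruction.
Variables (M : leftModule A) (n : nat).
Variable xi : 'I_n.+1 -> {linear A -> {linear M -> M}}.

Definition obstruction_mod_fun (x : 'I_2 -> A) : {linear M -> M} :=
  - \sum_(p : 'I_n.+1 * 'I_n.+1 | [&& p.1 + p.2 == n.+1, 0 < p.1 & 0 < p.2]%N)
      hom_comp (xi p.1 (x ord0)) (xi p.2 (x ord_max)).

Fact obstruction_mod_multilinear : multilinear obstruction_mod_fun.
Proof.
move=> i x c u v; rewrite /obstruction_mod_fun scalerN scaler_sumr -opprD.
rewrite -big_split; congr (- _); apply: eq_bigr => p _ /=.
have [->|->] : i = ord0 \/ i = ord_max.
- by case: i => -[|[|//]] ?; [left|right]; apply: val_inj.
- by rewrite linearP hom_comp_linear_l.
- by rewrite linearP hom_comp_linear_r.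
Qed.

Definition obstruction_mod : cochain 2 A {linear M -> M} :=
  mk_cochain obstruction_mod_multilinear.

End ModuleObstruction.

Variables (M N : leftModule A) (phi : moduleHom M N).

Section HomObstruction.
Variable n : nat.
Variable xi : 'I_n.+1 -> {linear A -> {linear M -> M}}.
Variable eta : 'I_n.+1 -> {linear A -> {linear N -> N}}.
Variable phi_ : 'I_n.+1 -> {linear M -> N}.

Definition obstruction_hom_fun (x : 'I_1 -> A) : {linear M -> N} :=
  \sum_(p : 'I_n.+1 * 'I_n.+1 | [&& p.1 + p.2 == n.+1, 0 < p.1 & 0 < p.2]%N)
      hom_comp (eta p.1 (x ord0)) (phi_ p.2)
  - \sum_(p : 'I_n.+1 * 'I_n.+1 | [&& p.1 + p.2 == n.+1, 0 < p.1 & 0 < p.2]%N)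
      hom_comp (phi_ p.1) (xi p.2 (x ord0)).

Fact obstruction_hom_multilinear : multilinear obstruction_hom_fun.
Proof.
move=> i x c u v; rewrite /obstruction_hom_fun -!sumrB scaler_sumr.
rewrite -big_split; apply: eq_bigr => p _ /=; rewrite (ord1 i) /= !linearP.
rewrite hom_comp_linear_l hom_comp_linear_r scalerBr opprD.
by rewrite [LHS]addrACA.
Qed.

Definition obstruction_hom : cochain 1 A {linear M -> N} :=
  mk_cochain obstruction_hom_multilinear.

End HomObstruction.

Definition obstruction n (D : deformation phi n) : Cphi M N 2 :=
  (obstruction_mod (def_xi D), obstruction_mod (def_eta D),
   obstruction_hom (def_xi D) (def_eta D) (def_phi D)).

End Obstruction.

Section Convolution.

Lemma conv_pairs (V : nmodType) (F : nat -> nat -> V) (n l : nat) :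
    (forall i j, (n <= i)%N || (n <= j)%N -> F i j = 0) ->
  \sum_(p : 'I_n * 'I_n | (p.1 + p.2 == l)%N) F p.1 p.2
  = \sum_(i < l.+1) F i (l - i)%N.
Proof.
move=> F0.
rewrite -(pair_big_dep xpredT (fun i j : 'I_n => (i + j == l)%N)
  (fun i j => F i j)) /=.
pose G (i : nat) : V := if (i <= l)%N then F i (l - i)%N else 0.
transitivity (\sum_(i < n) G i).
  apply: eq_bigr => i _; rewrite /G; case: leqP => il; last first.
    by apply: big_pred0 => j; lia.
  case: (ltnP (l - i) n) => ln.
    by rewrite (big_pred1 (Ordinal ln)) // => j /=; rewrite ord_cases /=; lia.
  by rewrite F0 ?ln ?orbT //; apply: big_pred0 => j; have := ltn_ord j; lia.
have G0 i : (n <= i)%N || (l < i)%N -> G i = 0.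
  by rewrite /G; case: leqP => // il /orP[ni|//]; apply: F0; rewrite ni.
transitivity (\sum_(i < n + l.+1) G i).
  rewrite big_split_ord /= [X in _ + X]big1 ?addr0 // => i _.
  by apply: G0; rewrite leq_addr.
rewrite addnC big_split_ord /= [X in _ + X]big1 ?addr0 => [|i _]; last first.
  by apply: G0; rewrite leq_addr orbT.
by apply: eq_bigr => i _; rewrite /G -ltnS ltn_ord.
Qed.

Lemma conv_triangle (V : nmodType) (F : nat -> nat -> nat -> V) (l : nat) :
  \sum_(i < l.+1) \sum_(j < (l - i).+1) F i j (l - i - j)%N
  = \sum_(i < l.+1) \sum_(j < i.+1) F j (i - j)%N (l - i)%N.
Proof.
transitivity (\sum_(i < l.+1) \sum_(j < l.+1 | (j <= i)%N)
    F j (i - j)%N (l - i)%N); last first.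
  apply: eq_bigr => i _.
  rewrite (big_ord_widen l.+1 (fun j => F j (i - j)%N (l - i)%N)) //.
rewrite (exchange_big_dep xpredT) //=; apply: eq_bigr => i _.
rewrite -(big_mkord xpredT (fun j => F i j (l - i - j)%N)).
rewrite -(big_mkord (fun j => (i <= j)%N) (fun j => F i (j - i)%N (l - j)%N)).
rewrite [RHS](big_cat_nat (n := i)) //=; last exact: ltnW.
rewrite [X in _ = X + _]big_nat_cond [X in _ = X + _]big_pred0 ?add0r; last first.
  by move=> j; lia.
transitivity (\sum_(0 <= j < l.+1 - i | (i <= j + i)%N)
    F i (j + i - i)%N (l - (j + i))%N); last first.
  exact/esym/(big_addn 0 l.+1 i (fun j => (i <= j)%N)
    (fun j => F i (j - i)%N (l - j)%N)).
rewrite (subSn (m := i)); last by rewrite -ltnS.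
rewrite [RHS]big_nat_cond [LHS]big_nat_cond.
apply: eq_big => [j|j _]; first by rewrite leq_addl; lia.
by congr F; lia.
Qed.

Variable k : comPzRingType.

Section Conv.
Variables (P Q S : lmodType k).
Implicit Types (f : nat -> {linear Q -> S}) (g : nat -> {linear P -> Q}).

Definition conv f g (l : nat) : {linear P -> S} :=
  \sum_(i < l.+1) hom_comp (f i) (g (l - i)%N).

Lemma hom_compDl (f f' : {linear Q -> S}) (g : {linear P -> Q}) :
  hom_comp (f + f') g = hom_comp f g + hom_comp f' g.
Proof. exact: (linearD (precomp S g)). Qed.

Lemma hom_compDr (f : {linear Q -> S}) (g g' : {linear P -> Q}) :
  hom_comp f (g + g') = hom_comp f g + hom_comp f g'.
Proof. exact: (linearD (postcomp P f)). Qed.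

Lemma hom_compNl (f : {linear Q -> S}) (g : {linear P -> Q}) :
  hom_comp (- f) g = - hom_comp f g.
Proof. exact: (linearN (precomp S g)). Qed.

Lemma hom_compNr (f : {linear Q -> S}) (g : {linear P -> Q}) :
  hom_comp f (- g) = - hom_comp f g.
Proof. exact: (linearN (postcomp P f)). Qed.

Lemma hom_comp0l (g : {linear P -> Q}) : hom_comp (0 : {linear Q -> S}) g = 0.
Proof. exact: (linear0 (precomp S g)). Qed.

Lemma hom_comp0r (f : {linear Q -> S}) : hom_comp f (0 : {linear P -> Q}) = 0.
Proof. exact: (linear0 (postcomp P f)). Qed.

Lemma hom_comp_suml (I : Type) (r : seq I) (p : pred I)
    (F : I -> {linear Q -> S}) (g : {linear P -> Q}) :
  hom_comp (\sum_(i <- r | p i) F i) g = \sum_(i <- r | p i) hom_comp (F i) g.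
Proof. exact: (linear_sum (precomp S g)). Qed.

Lemma hom_comp_sumr (I : Type) (r : seq I) (p : pred I)
    (f : {linear Q -> S}) (F : I -> {linear P -> Q}) :
  hom_comp f (\sum_(i <- r | p i) F i) = \sum_(i <- r | p i) hom_comp f (F i).
Proof. exact: (linear_sum (postcomp P f)). Qed.

Lemma conv_eql f f' g n : (forall l, (l <= n)%N -> f l = f' l) ->
  conv f g n.+1 = conv f' g n.+1 + hom_comp (f n.+1 - f' n.+1) (g 0%N).
Proof.
move=> ff'; rewrite /conv big_ord_recr [in RHS]big_ord_recr /= subnn.
rewrite hom_compDl hom_compNl -addrA addrC [hom_comp (f' _) _ + _]addrC subrK.
by rewrite addrC; congr (_ + _); apply: eq_bigr => i _; rewrite ff' // -ltnS.
Qed.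

Lemma conv_eqr f g g' n : (forall l, (l <= n)%N -> g l = g' l) ->
  conv f g n.+1 = conv f g' n.+1 + hom_comp (f 0%N) (g n.+1 - g' n.+1).
Proof.
move=> gg'; rewrite /conv big_ord_recl [in RHS]big_ord_recl /= subn0.
rewrite hom_compDr hom_compNr addrAC [_ + (_ - _)]addrC subrK; congr (_ + _).
by apply: eq_bigr => i _; rewrite gg' // /bump /= add1n subSS leq_subr.
Qed.

End Conv.

Lemma convA (P Q S T : lmodType k) (f : nat -> {linear S -> T})
    (g : nat -> {linear Q -> S}) (h : nat -> {linear P -> Q}) l :
  conv f (conv g h) l = conv (conv f g) h l.
Proof.
pose F i j m : {linear P -> T} := hom_comp (f i) (hom_comp (g j) (h m)).
transitivity (\sum_(i < l.+1) \sum_(j < (l - i).+1) F i j (l - i - j)%N).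
  by apply: eq_bigr => i _; rewrite hom_comp_sumr.
rewrite conv_triangle; apply: eq_bigr => i _.
rewrite hom_comp_suml; apply: eq_bigr => j _.
exact: linear_ext.
Qed.

End Convolution.

Section ObstructionCocycle.
Variables (k : comPzRingType) (A : assocAlgebra k).

Definition coef0 (V : nmodType) n (f : 'I_n.+1 -> V) (i : nat) : V :=
  if insub i is Some j then f j else 0.

Lemma coef0E (V : nmodType) n (f : 'I_n.+1 -> V) (i : 'I_n.+1) :
  coef0 f i = f i.
Proof. by rewrite /coef0 valK. Qed.

Lemma coef0_big (V : nmodType) n (f : 'I_n.+1 -> V) i :
  (n < i)%N -> coef0 f i = 0.
Proof. by move=> ni; rewrite /coef0 insubF // ltnS leqNgt ni. Qed.

Lemma sum_conv (P Q S : lmodType k) n (f : 'I_n.+1 -> {linear Q -> S})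
    (g : 'I_n.+1 -> {linear P -> Q}) l :
  \sum_(p : 'I_n.+1 * 'I_n.+1 | (p.1 + p.2 == l)%N) hom_comp (f p.1) (g p.2)
  = conv (coef0 f) (coef0 g) l.
Proof.
transitivity (\sum_(p : 'I_n.+1 * 'I_n.+1 | (p.1 + p.2 == l)%N)
    hom_comp (coef0 f p.1) (coef0 g p.2)).
  by apply: eq_bigr => p _; rewrite !coef0E.
apply: (conv_pairs (F := fun i j => hom_comp (coef0 f i) (coef0 g j))).
move=> i j /orP[] ni; rewrite (coef0_big _ ni) ?hom_comp0l ?hom_comp0r //.
Qed.

Lemma sum_conv_pos (P Q S : lmodType k) n (f : 'I_n.+1 -> {linear Q -> S})
    (g : 'I_n.+1 -> {linear P -> Q}) :
  \sum_(p : 'I_n.+1 * 'I_n.+1 | [&& p.1 + p.2 == n.+1, 0 < p.1 & 0 < p.2]%N)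
    hom_comp (f p.1) (g p.2)
  = conv (coef0 f) (coef0 g) n.+1.
Proof.
rewrite -sum_conv; apply: eq_bigl => -[i j] /=.
by have := ltn_ord i; have := ltn_ord j; lia.
Qed.

Lemma obstruction_modE (M : leftModule A) n
    (xi : 'I_n.+1 -> {linear A -> {linear M -> M}}) (x : 'I_2 -> A) :
  obstruction_mod xi x =
  - conv (coef0 (xi^~ (x ord0))) (coef0 (xi^~ (x ord_max))) n.+1.
Proof.
congr (- _).
exact: (sum_conv_pos (xi^~ (x ord0)) (xi^~ (x ord_max))).
Qed.

Lemma module_deformation_conv (M : leftModule A) n
    (xi : 'I_n.+1 -> {linear A -> {linear M -> M}}) r s l :
    module_deformation xi -> (l <= n)%N ->
  conv (coef0 (xi^~ r)) (coef0 (xi^~ s)) l = coef0 (xi^~ (amul r s)) l.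
Proof.
move=> [_ xiM] ln; have lt_l : (l < n.+1)%N by [].
rewrite -(sum_conv (xi^~ r) (xi^~ s)) -(xiM (Ordinal lt_l) r s).
exact/esym/(coef0E (xi^~ (amul r s)) (Ordinal lt_l)).
Qed.

Definition arg1 (a : A) : 'I_1 -> A := fun=> a.
Definition arg2 (a b : A) : 'I_2 -> A := fun i => if i == ord0 then a else b.

Lemma arg1E (x : 'I_1 -> A) : x = arg1 (x ord0).
Proof. by apply: funext => i; rewrite (ord1 i). Qed.

Lemma arg2E (x : 'I_2 -> A) : x = arg2 (x ord0) (x ord_max).
Proof.
apply: funext => i; rewrite /arg2.
by case: i => -[|[|//]] ? /=; congr x; apply: val_inj.
Qed.

Section LowDegree.
Variable F : bimodule A.

Lemma hochschild0E (f : cochain 0 A F) (x : 'I_1 -> A) y :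
  hochschild f x = lact (x ord0) (f y) - ract (x ord0) (f y).
Proof.
rewrite /= /hochschild_fun big_ord0 addr0 expr1 scaleN1r.
have -> : tail_arg x = y by apply: funext => -[].
have -> : init_arg x = y by apply: funext => -[].
by have -> : ord_max = ord0 :> 'I_1 by apply: val_inj.
Qed.

Lemma hochschild1E (f : cochain 1 A F) (x : 'I_2 -> A) :
  hochschild f x =
    lact (x ord0) (f (arg1 (x ord_max))) - f (arg1 (amul (x ord0) (x ord_max)))
    + ract (x ord_max) (f (arg1 (x ord0))).
Proof.
rewrite /= /hochschild_fun big_ord_recl big_ord0 addr0 expr1 scaleN1r.
rewrite sqrrN expr1n scale1r [tail_arg x]arg1E [init_arg x]arg1E.
rewrite [merge_arg _ x]arg1E /tail_arg /init_arg /merge_arg /=.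
have -> : lift ord0 ord0 = ord_max :> 'I_2 by apply: val_inj.
by have -> : widen_ord (leqnSn 1) ord0 = ord0 by apply: val_inj.
Qed.

Lemma hochschild2E (f : cochain 2 A F) (x : 'I_3 -> A) :
  let a := x ord0 in let b := x (lift ord0 ord0) in let c := x ord_max in
  hochschild f x = lact a (f (arg2 b c)) - f (arg2 (amul a b) c)
    + f (arg2 a (amul b c)) - ract c (f (arg2 a b)).
Proof.
rewrite /= /hochschild_fun !big_ord_recl big_ord0 addr0 expr1 scaleN1r.
rewrite /= /bump /= sqrrN expr1n scale1r exprSr sqrrN expr1n mul1r scaleN1r.
rewrite addrA [tail_arg x]arg2E [init_arg x]arg2E.
rewrite [merge_arg _ x]arg2E [merge_arg (lift _ _) x]arg2E.
rewrite /tail_arg /init_arg /merge_arg /=.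
have -> : lift ord0 ord_max = ord_max :> 'I_3 by apply: val_inj.
have -> : widen_ord (leqnSn 2) ord0 = ord0 by apply: val_inj.
by have -> : widen_ord (leqnSn 2) ord_max = lift ord0 ord0 by apply: val_inj.
Qed.

End LowDegree.

Lemma hochschild_hochschild0 (F : bimodule A) (f : cochain 0 A F) :
  hochschild (hochschild f) = 0.
Proof.
have cancel (p q r : F) : p - q + (- p - - r) + (q - r) = 0.
  rewrite opprK [X in X + _]addrACA subrr add0r addrACA addNr add0r.
  exact: subrr.
apply: cochain_ext => x; rewrite cochain0E hochschild1E.
have y : 'I_0 -> A by case.
by rewrite !(hochschild0E _ _ y) /arg1 lactM ractM !linearB /= lractC cancel.
Qed.

Lemma hochschild_hochschild1 (F : bimodule A) (f : cochain 1 A F) :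
  hochschild (hochschild f) = 0.
Proof.
have cancel (p q s t u v : F) : p - s + q + (- p - - t - u) + (s - t + v)
    + (- q - - u - v) = 0.
  rewrite !opprK [X in X + _ + _]addrACA [X in X + _ + _ + _]addrACA subrr add0r.
  rewrite -[LHS]addrA [X in _ + X]addrACA subrr addr0 [LHS]addrACA.
  rewrite [X in X + _]addrACA addNr subrr addr0 add0r.
  by rewrite addrACA subrr addNr addr0.
apply: cochain_ext => x; rewrite cochain0E hochschild2E !hochschild1E /arg2 /=.
by rewrite !linearD !linearN /= lactM ractM lractC amulA cancel.
Qed.

Lemma hochschild_map (F G : bimodule A) (g : {linear F -> G}) n
    (f : cochain n A F) :
    (forall a y, g (lact a y) = lact a (g y)) ->
    (forall a y, g (ract a y) = ract a (g y)) ->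
  hochschild (cochain_map g f) = cochain_map g (hochschild f).
Proof.
move=> gl gr; apply: cochain_ext => x /=; rewrite /hochschild_fun.
rewrite !linearD linear_sum linearZ_LR gl gr; congr (_ + _ + _).
by apply: eq_bigr => i _; rewrite linearZ_LR.
Qed.

Lemma obstruction_mod_cocycle (M : leftModule A) n
    (xi : 'I_n.+1 -> {linear A -> {linear M -> M}}) :
  module_deformation xi ->
  hochschild (F := endBimodule M) (obstruction_mod xi) = 0.
Proof.
move=> xiP; apply: cochain_ext => x; rewrite cochain0E hochschild2E.
set a := x ord0; set b := x _; set c := x _.
pose X r := coef0 (xi^~ r); pose O r s := obstruction_mod xi (arg2 r s).
have CE r s : conv (X r) (X s) n.+1 = - O r s.
  by rewrite /O obstruction_modE opprK.
have X0 r : X r 0%N = act M r.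
  by rewrite -xiP.1; exact: (coef0E (xi^~ r) ord0).
have Xn r : X r n.+1 = 0 by exact: coef0_big.
have XM r s l : (l <= n)%N -> conv (X r) (X s) l = X (amul r s) l.
  exact: module_deformation_conv.
change (hom_comp (act M a) (O b c) - O (amul a b) c + O a (amul b c)
  - hom_comp (O a b) (act M c) = 0).
clearbody O.
have := convA (X a) (X b) (X c) n.+1.
rewrite (conv_eqr _ (XM b c)) (conv_eql _ (XM a b)) !Xn !subr0 !X0 !CE.
rewrite hom_compNl hom_compNr -!opprD => /oppr_inj E.
rewrite [X in X - _]addrAC [X in X - _ - _]addrC E.
by rewrite [X in X - _]addrAC subrr add0r subrr.
Qed.

Lemma obstruction_homE (M N : leftModule A) n
    (xi : 'I_n.+1 -> {linear A -> {linear M -> M}})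
    (eta : 'I_n.+1 -> {linear A -> {linear N -> N}})
    (phi_ : 'I_n.+1 -> {linear M -> N}) (x : 'I_1 -> A) :
  obstruction_hom xi eta phi_ x =
  conv (coef0 (eta^~ (x ord0))) (coef0 phi_) n.+1
  - conv (coef0 phi_) (coef0 (xi^~ (x ord0))) n.+1.
Proof.
congr (_ - _); first exact: (sum_conv_pos (eta^~ (x ord0)) phi_).
exact: (sum_conv_pos phi_ (xi^~ (x ord0))).
Qed.

Variables (M N : leftModule A) (phi : moduleHom M N).

Lemma obstruction_hom_cocycle n
    (xi : 'I_n.+1 -> {linear A -> {linear M -> M}})
    (eta : 'I_n.+1 -> {linear A -> {linear N -> N}})
    (phi_ : 'I_n.+1 -> {linear M -> N}) :
  hom_deformation phi xi eta phi_ ->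
  hochschild (F := homBimodule M N) (obstruction_hom xi eta phi_)
  = cochain_map (postcomp M phi) (obstruction_mod xi)
    - cochain_map (precomp N phi) (obstruction_mod eta).
Proof.
move=> [xiP etaP phi0 phiP]; apply: cochain_ext => x.
rewrite cochainDE cochainNE hochschild1E [in RHS](arg2E x).
set a := x ord0; set b := x _.
pose X r := coef0 (xi^~ r); pose Y r := coef0 (eta^~ r); pose P := coef0 phi_.
pose O1 r s := obstruction_mod xi (arg2 r s).
pose O2 r s := obstruction_mod eta (arg2 r s).
pose O3 r := obstruction_hom xi eta phi_ (arg1 r).
have C1 r s : conv (X r) (X s) n.+1 = - O1 r s.
  by rewrite /O1 obstruction_modE opprK.
have C2 r s : conv (Y r) (Y s) n.+1 = - O2 r s.
  by rewrite /O2 obstruction_modE opprK.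
have C3 r : conv P (X r) n.+1 = conv (Y r) P n.+1 - O3 r.
  by rewrite /O3 obstruction_homE opprB addrC subrK.
have X0 r : X r 0%N = act M r.
  by rewrite -xiP.1; exact: (coef0E (xi^~ r) ord0).
have Y0 r : Y r 0%N = act N r.
  by rewrite -etaP.1; exact: (coef0E (eta^~ r) ord0).
have P0 : P 0%N = phi by rewrite -phi0; exact: (coef0E phi_ ord0).
have Xn r : X r n.+1 = 0 by exact: coef0_big.
have Yn r : Y r n.+1 = 0 by exact: coef0_big.
have XM r s l : (l <= n)%N -> conv (X r) (X s) l = X (amul r s) l.
  exact: module_deformation_conv.
have YM r s l : (l <= n)%N -> conv (Y r) (Y s) l = Y (amul r s) l.
  exact: module_deformation_conv.
have PXY r l : (l <= n)%N -> conv P (X r) l = conv (Y r) P l.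
  rewrite -ltnS => ln; rewrite -(sum_conv phi_ (xi^~ r)).
  rewrite -(sum_conv (eta^~ r) phi_); apply: linear_ext => m.
  by rewrite !hom_sumE; exact: (phiP (Ordinal ln) r m).
change (hom_comp (act N a) (O3 b) - O3 (amul a b) + hom_comp (O3 a) (act M b)
  = hom_comp phi (O1 a b) - hom_comp (O2 a b) phi).
clearbody O1 O2 O3.
have := convA P (X a) (X b) n.+1.
rewrite (conv_eqr _ (XM a b)) (conv_eql _ (PXY a)) -convA (conv_eqr _ (PXY b)).
rewrite convA (conv_eql _ (YM a b)) !Xn !Yn !subr0 X0 Y0 P0 C1 C2 !C3.
have subK (u v : {linear M -> N}) : u - v - u = - v by rewrite addrAC subrr add0r.
rewrite !subK !hom_compNl !hom_compNr -!addrA => /addrI.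
rewrite -!opprD => /oppr_inj E.
have {}E : hom_comp (act N a) (O3 b) + hom_comp (O3 a) (act M b)
    = O3 (amul a b) + hom_comp phi (O1 a b) - hom_comp (O2 a b) phi.
  by rewrite E [RHS]addrAC subrr add0r.
by rewrite addrA addrAC E addrAC [_ + hom_comp phi _]addrC addrK.
Qed.

Lemma dphi_dphi (c : Cphi M N 1) : dphi phi (dphi phi c) = 0.
Proof.
case: c => [[u v] w]; rewrite /dphi !hochschild_hochschild1.
congr (_, _, _); rewrite !linearB /= hochschild_hochschild0.
rewrite !oppr0 addr0.
have -> : hochschild (F := homBimodule M N) (cochain_map (postcomp M phi) u)
    = cochain_map (postcomp M phi) (hochschild (F := endBimodule M) u).
  apply: (@hochschild_map (endBimodule M) (homBimodule M N)) => a f;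
    apply: linear_ext => m //=; exact: mhomA.
have -> : hochschild (F := homBimodule M N) (cochain_map (precomp N phi) v)
    = cochain_map (precomp N phi) (hochschild (F := endBimodule N) v).
  apply: (@hochschild_map (endBimodule N) (homBimodule M N)) => a f;
    apply: linear_ext => m //=; congr (f _); exact/esym/mhomA.
by rewrite -opprD subrr.
Qed.

Lemma obstruction_cocycle n (D : deformation phi n) :
  dphi phi (obstruction D) = 0.
Proof.
have defD := deformationP D; have [xiP etaP _ _] := defD.
rewrite /dphi /obstruction obstruction_hom_cocycle // subrr.
by rewrite !obstruction_mod_cocycle.
Qed.

Definition obstruction_class n (D : deformation phi n) : H2 phi :=
  cohomology_class (@dphi _ _ _ _ phi 0) (obstruction_cocycle D).

End ObstructionCocycle.

(* Main.v *)
Require Import Defs.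
From mathcomp Require Import all_boot all_algebra.
From mathcomp Require Import boolp.

Import GRing.Theory.
Local Open Scope ring_scope.

(** The equations defining a deformation of order n + 1 are graded by the power
    of t.  Below t^{n+1} they involve only the coefficients of the given
    deformation of order n, hence hold already.  At t^{n+1} the new coefficients
    (xi', eta', phi') occur linearly, multiplied by the coefficients of t^0,
    which are the two actions and phi; all the other terms of the convolution
    sums form the obstruction.  Separating the two kinds of terms
    ([conv_add_term_top]) turns the three equations at t^{n+1} into
    d^1 (xi', eta', phi') = Ob ([hom_deformation_add_term]).  Since 1-cochains are
    linear maps and 0-cochains are elements, the triple (xi', eta', phi') ranges
    over the whole of C^1(phi), so an extension exists exactly when Ob is in the
    image of d^1, which is the vanishing of its class
    ([cohomology_class_eq0]). *)

Section Extension.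

Set Implicit Arguments.
Unset Strict Implicit.
Unset Printing Implicit Defensive.

(** Stated for an abstract closed predicate, so that rewriting in the quotient
    does not have to unfold the coboundary predicate. *)
Lemma quot_pi_eq0 (V : zmodType) (I : zmodClosed V) (x : V) :
  (\pi_(Quotient.quot I) x)%qT = 0 <-> x \in I.
Proof.
rewrite -[0](@pi_zeror _ _ _ _ _ (Quotient.quot I)).
by split=> [/eqP|xI]; last apply/eqP; rewrite -Quotient.idealrBE subr0.
Qed.

Lemma cohomology_class_eq0 (k : comPzRingType) (X Y Z : lmodType k)
    (f : {linear X -> Y}) (g : {linear Y -> Z}) (y : Y) (gy : g y = 0) :
  cohomology_class f gy = 0 <-> exists x, f x = y.
Proof.
apply: (iff_trans (quot_pi_eq0 (coboundary_pred f (g := g)) _)).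
by split=> [/asboolP | fy]; last apply/asboolP.
Qed.

Section LowDegreeCochains.
Variables (k : comPzRingType) (U F : lmodType k).

Fact elt_cochain_multilinear (y : F) : multilinear (fun _ : 'I_0 -> U => y).
Proof. by case. Qed.

Definition elt_cochain (y : F) : cochain 0 U F :=
  mk_cochain (elt_cochain_multilinear y).

Lemma elt_cochain_surj (c : cochain 0 U F) : exists y, elt_cochain y = c.
Proof.
have x : 'I_0 -> U by case.
exists (c x); apply: cochain_ext => z /=.
by congr (c _); apply: funext => -[].
Qed.

Fact lin_cochain_multilinear (g : {linear U -> F}) :
  multilinear (fun x : 'I_1 -> U => g (x ord0)).
Proof. by move=> i x c u v; rewrite (ord1 i) /= linearP. Qed.

Definition lin_cochain (g : {linear U -> F}) : cochain 1 U F :=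
  mk_cochain (lin_cochain_multilinear g).

Lemma lin_cochain_surj (c : cochain 1 U F) : exists g, lin_cochain g = c.
Proof.
have lc : linear (fun a => c (fun=> a)).
  move=> d u v.
  have E a : (fun=> a) = [eta (fun=> 0) with ord0 |-> a] :> ('I_1 -> U).
    by apply: funext => i /=; rewrite (ord1 i).
  by have := cochain_multilinear c ord0 (fun=> 0) d u v; rewrite -!E.
exists (linear_pack lc); apply: cochain_ext => x /=.
by congr (c _); apply: funext => i; rewrite (ord1 i).
Qed.

End LowDegreeCochains.

Section AddTerm.
Variable n : nat.

Lemma add_term_lift (T : Type) (f : 'I_n.+1 -> T) y i :
  add_term f y (lift ord_max i) = f i.
Proof. by rewrite /add_term liftK. Qed.

Lemma add_term_max (T : Type) (f : 'I_n.+1 -> T) y :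
  add_term f y ord_max = y.
Proof. by rewrite /add_term unlift_none. Qed.

Lemma add_term0 (T : Type) (f : 'I_n.+1 -> T) y :
  add_term f y ord0 = f ord0.
Proof.
by rewrite -(add_term_lift f y); congr add_term; apply: val_inj.
Qed.

Lemma add_term_comp (T T' : Type) (h : T -> T') (f : 'I_n.+1 -> T) y :
  (fun i => h (add_term f y i)) = add_term (fun i => h (f i)) (h y).
Proof. by apply: funext => i; rewrite /add_term; case: unlift. Qed.

Lemma coef0_add_term (V : nmodType) (f : 'I_n.+1 -> V) (y : V) l :
  (l <= n)%N -> Defs.coef0 (add_term f y) l = Defs.coef0 f l.
Proof.
rewrite -ltnS => ln; pose i := Ordinal ln.
rewrite [RHS](coef0E f i) -(add_term_lift f y) -(coef0E (add_term f y)).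
by congr (Defs.coef0 _ _); rewrite lift_max.
Qed.

Lemma coef0_add_term_max (V : nmodType) (f : 'I_n.+1 -> V) (y : V) :
  Defs.coef0 (add_term f y) n.+1 = y.
Proof.
by rewrite [LHS](coef0E (add_term f y) ord_max) add_term_max.
Qed.

Variables (k : comPzRingType) (P Q S : lmodType k).
Variables (f : 'I_n.+1 -> {linear Q -> S}) (g : 'I_n.+1 -> {linear P -> Q}).
Variables (y : {linear Q -> S}) (z : {linear P -> Q}).

Lemma conv_add_term l : (l <= n)%N ->
  conv (Defs.coef0 (add_term f y)) (Defs.coef0 (add_term g z)) l
  = conv (Defs.coef0 f) (Defs.coef0 g) l.
Proof.
move=> ln; apply: eq_bigr => i _; rewrite !coef0_add_term //.
  by rewrite (leq_trans _ ln) ?leq_subr.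
by rewrite (leq_trans _ ln) // -ltnS.
Qed.

(** Degree n + 1 sees the new coefficients y and z only next to a coefficient of
    degree 0.  As [coef0] pads f and g with zeros beyond n, the convolution of the
    old coefficients on the right is the sum over i, j > 0. *)
Lemma conv_add_term_top :
  conv (Defs.coef0 (add_term f y)) (Defs.coef0 (add_term g z)) n.+1
  = conv (Defs.coef0 f) (Defs.coef0 g) n.+1
    + hom_comp (f ord0) z + hom_comp y (g ord0).
Proof.
rewrite (conv_eql _ (coef0_add_term f y)) (conv_eqr _ (coef0_add_term g z)).
rewrite !coef0_add_term_max !(coef0_big _ (ltnSn n)) !subr0 coef0_add_term //.
by rewrite -(coef0E f) -(coef0E g).
Qed.

End AddTerm.

Variables (k : comPzRingType) (A : assocAlgebra k).

Lemma forall_ordS n (E : 'I_n.+2 -> Prop) :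
  (forall l, E l) <-> (forall l : 'I_n.+1, E (lift ord_max l)) /\ E ord_max.
Proof.
split=> [H|[H1 H2] l]; first by split.
by case: (unliftP ord_max l) => [j|] ->.
Qed.

Lemma add_term_app n (U P Q : lmodType k)
    (f : 'I_n.+1 -> {linear U -> {linear P -> Q}}) f' u :
  (add_term f f')^~ u = add_term (f^~ u) (f' u).
Proof. exact: (add_term_comp (fun h : {linear U -> _} => h u)). Qed.

(** The top equation reads xi'(rs) = r xi'(s) + xi'(r) s - O(r, s), the minus
    sign being the one in the definition of the obstruction; this is
    delta xi' = O. *)
Lemma module_deformation_add_term (M : leftModule A) n
    (xi : 'I_n.+1 -> {linear A -> {linear M -> M}}) xi' :
    module_deformation xi ->
  module_deformation (add_term xi xi') <->
  hochschild (F := endBimodule M) (lin_cochain xi') = obstruction_mod xi.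
Proof.
move=> xiP; pose X r := Defs.coef0 (add_term (xi^~ r) (xi' r)).
have XE l r s : \sum_(p : 'I_n.+2 * 'I_n.+2 | (p.1 + p.2 == l)%N)
      hom_comp (add_term xi xi' p.1 r) (add_term xi xi' p.2 s)
    = conv (X r) (X s) l.
  by rewrite (sum_conv ((add_term xi xi')^~ r) ((add_term xi xi')^~ s))
    !add_term_app.
have low (l : 'I_n.+1) r s : add_term xi xi' (lift ord_max l) (amul r s) =
    \sum_(p : 'I_n.+2 * 'I_n.+2 | (p.1 + p.2 == lift ord_max l)%N)
      hom_comp (add_term xi xi' p.1 r) (add_term xi xi' p.2 s).
  rewrite XE /X lift_max (conv_add_term _ _ _ _ (leq_ord l)) add_term_lift.
  by rewrite (module_deformation_conv _ _ xiP (leq_ord l)) coef0E.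
have top r s : \sum_(p : 'I_n.+2 * 'I_n.+2 | (p.1 + p.2 == n.+1)%N)
      hom_comp (add_term xi xi' p.1 r) (add_term xi xi' p.2 s)
    = hom_comp (act M r) (xi' s) + hom_comp (xi' r) (act M s)
      - obstruction_mod xi (arg2 r s).
  rewrite XE /X conv_add_term_top obstruction_modE opprK xiP.1.
  by rewrite -addrA addrC.
have split_eq (a b c o : {linear M -> M}) : c = a + b - o <-> a - c + b = o.
  by rewrite [a - c + b]addrAC; split=> [->|<-]; rewrite subKr.
split=> [[_ E] | E].
  apply: cochain_ext => x; rewrite hochschild1E [in RHS](arg2E x).
  by apply/split_eq; rewrite -top -(E ord_max) add_term_max.
split; first by rewrite add_term0 xiP.1.
apply/forall_ordS; split=> // r s; rewrite top add_term_max.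
by apply/split_eq; rewrite -E hochschild1E.
Qed.

Variables (M N : leftModule A) (phi : moduleHom M N).

(** The first two components are the statement above for M and N.  In the third,
    the terms phi' r and r phi' of the commutation equation form the coboundary
    of the 0-cochain phi', since delta^0 (w)(r) = r w - w r, and the terms with
    xi' and eta' form phi u - v phi. *)
Lemma hom_deformation_add_term n
    (xi : 'I_n.+1 -> {linear A -> {linear M -> M}})
    (eta : 'I_n.+1 -> {linear A -> {linear N -> N}})
    (phi_ : 'I_n.+1 -> {linear M -> N}) xi' eta' phi' :
    hom_deformation phi xi eta phi_ ->
  hom_deformation phi (add_term xi xi') (add_term eta eta')
    (add_term phi_ phi') <->
  dphi phi ((lin_cochain xi', lin_cochain eta', elt_cochain A phi')
    : Cphi M N 1)
  = (obstruction_mod xi, obstruction_mod eta, obstruction_hom xi eta phi_).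
Proof.
move=> [xiP etaP phi0 phiP].
pose X r := Defs.coef0 (add_term (xi^~ r) (xi' r)).
pose Y r := Defs.coef0 (add_term (eta^~ r) (eta' r)).
pose P := Defs.coef0 (add_term phi_ phi').
have PXE l r : \sum_(p : 'I_n.+2 * 'I_n.+2 | (p.1 + p.2 == l)%N)
      hom_comp (add_term phi_ phi' p.1) (add_term xi xi' p.2 r)
    = conv P (X r) l.
  by rewrite (sum_conv (add_term phi_ phi') ((add_term xi xi')^~ r))
    add_term_app.
have YPE l r : \sum_(p : 'I_n.+2 * 'I_n.+2 | (p.1 + p.2 == l)%N)
      hom_comp (add_term eta eta' p.1 r) (add_term phi_ phi' p.2)
    = conv (Y r) P l.
  by rewrite (sum_conv ((add_term eta eta')^~ r) (add_term phi_ phi'))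
    add_term_app.
have commE (l : 'I_n.+2) :
    (forall r m, \sum_(p : 'I_n.+2 * 'I_n.+2 | (p.1 + p.2 == l)%N)
        add_term phi_ phi' p.1 (add_term xi xi' p.2 r m)
      = \sum_(p : 'I_n.+2 * 'I_n.+2 | (p.1 + p.2 == l)%N)
        add_term eta eta' p.1 r (add_term phi_ phi' p.2 m))
    <-> (forall r, conv P (X r) l = conv (Y r) P l).
  split=> [E r|E r m].
    rewrite -PXE -YPE; apply: linear_ext => m; rewrite !hom_sumE.
    exact: E.
  have := congr1 (fun h : {linear M -> N} => h m) (E r).
  by rewrite -PXE -YPE !hom_sumE.
have low (l : 'I_n.+1) r : conv P (X r) (lift ord_max l)
    = conv (Y r) P (lift ord_max l).
  rewrite /P /X /Y lift_max !(conv_add_term _ _ _ _ (leq_ord l)).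
  rewrite -(sum_conv phi_ (xi^~ r)) -(sum_conv (eta^~ r) phi_).
  by apply: linear_ext => m; rewrite !hom_sumE; exact: phiP.
have top r : conv P (X r) n.+1 = conv (Y r) P n.+1 <->
    hom_comp phi (xi' r) - hom_comp (eta' r) phi
      - (hom_comp (act N r) phi' - hom_comp phi' (act M r))
    = obstruction_hom xi eta phi_ (arg1 r).
  rewrite /P /X /Y !conv_add_term_top obstruction_homE phi0 xiP.1 etaP.1 /arg1.
  set a := conv _ _ _; set b := hom_comp _ _; set c := hom_comp _ _.
  set d := conv _ _ _; set e := hom_comp _ _; set f := hom_comp _ _.
  have E : b - f - (e - c) - (d - a) = a + b + c - (d + e + f).
    by rewrite !opprB !opprD (AC (2*2*2) ((5*1*3)*(6*4*2))).
  by split=> H; apply/subr0_eq; [rewrite E|rewrite -E]; rewrite H subrr.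
have d3E r : (dphi phi ((lin_cochain xi', lin_cochain eta',
      elt_cochain A phi') : Cphi M N 1)).2 (arg1 r)
    = hom_comp phi (xi' r) - hom_comp (eta' r) phi
      - (hom_comp (act N r) phi' - hom_comp phi' (act M r)).
  have y : 'I_0 -> A by case.
  exact: (congr1 (+%R _ \o -%R) (hochschild0E (F := homBimodule M N)
    (elt_cochain A phi') (arg1 r) y)).
split=> [[xiP' etaP' _ /forall_ordS[_ /commE E]] | E].
  move: xiP' etaP' => /(module_deformation_add_term _ xiP) E1.
  move=> /(module_deformation_add_term _ etaP) E2.
  rewrite [LHS]surjective_pairing; congr (_, _); first by rewrite /= E1 E2.
  apply: cochain_ext => x; rewrite [x]arg1E d3E.
  exact/top/E.
split.
- apply/(module_deformation_add_term _ xiP).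
  exact: (congr1 (fun c : Cphi M N 2 => c.1.1) E).
- apply/(module_deformation_add_term _ etaP).
  exact: (congr1 (fun c : Cphi M N 2 => c.1.2) E).
- by rewrite add_term0.
apply/forall_ordS; split=> [l|]; apply/commE => r; first exact: low.
by apply/top; rewrite -d3E E.
Qed.

End Extension.

Theorem theorem4p2 (k : comPzRingType) (A : assocAlgebra k)
    (M N : leftModule A) (phi : moduleHom M N) (n : nat)
    (D : deformation phi n) :
  extends D <-> obstruction_class D = 0.
Proof.
have defD := deformationP D.
apply: iff_sym; apply: (iff_trans (cohomology_class_eq0 _ _)); split.
- move=> [[[u v] w]].
  have [xi' <-] := lin_cochain_surj u.
  have [eta' <-] := lin_cochain_surj v.
  have [phi' <-] := elt_cochain_surj w.
  by move/(hom_deformation_add_term _ _ _ defD); exists xi', eta', phi'.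
move=> [xi' [eta' [phi' /(hom_deformation_add_term _ _ _ defD) E]]].
by eexists; exact: E.
Qed.
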